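(* Let $d\ge 1$, let $\Omega\subset\mathbb{R}^d$ be a compact convex set and let $\nu$ be a Borel probability measure on $\Omega$ with $\nu\ll\mathcal{L}^d$. Then there exist positive constants $C_1$ and $C_2$, which do not depend on the choice of the sequence $\{\Sigma'_n\}_{n\ge 1}$ of solutions to the short-term optimal location problem, such that for every such sequence, with $s_n:=F(\Sigma'_n)$, \[ C_1 n^{-1/d}\le s_n\le C_2 n^{-1/d}\qquad\text{for all } n\ge 1 . \]
   Context: $\mathcal{L}^d$ is the Lebesgue measure on $\mathbb{R}^d$. For a finite nonempty set $\Sigma\subset\Omega$ put $F(\Sigma):=\int_\Omega \mathrm{dist}(x,\Sigma)\,d\nu(x)$, where $\mathrm{dist}(x,\Sigma)$ is the Euclidean distance from $x$ to $\Sigma$. A sequence of solutions to the short-term optimal location problem is a sequence $\{\Sigma'_n\}_{n\ge1}$ of sets such that, with $\Sigma'_0:=\emptyset$, for each $n\ge 1$ the set $\Sigma'_n$ minimizes $F$ among all sets $\Sigma$ with $\Sigma'_{n-1}\subset\Sigma\subset\Omega$ and $\#\Sigma\le n$ ($\Sigma$ nonempty). Such a sequence need not be unique, and $s_n$ may depend on the chosen sequence. The constants $C_1,C_2$ may depend on $d$, $\Omega$ and $\nu$, but not on $n$ or on the chosen sequence. *)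

(* Defs.v *)
From HB Require Import structures.
From mathcomp Require Import all_boot all_order all_algebra.
From mathcomp Require Import all_classical all_reals all_analysis.

Set Implicit Arguments.
Unset Strict Implicit.
Unset Printing Implicit Defensive.

Import Order.TTheory GRing.Theory Num.Theory.
Import numFieldNormedType.Exports.

Local Open Scope classical_set_scope.
Local Open Scope ring_scope.

(* Points of R^d are row vectors; this copy of the type carries the Borel
   sigma-algebra, generated by the open sets of the product topology. *)
Definition borel_space (R : realType) (d : nat) :=
  g_sigma_algebraType (@open 'rV[R]_d).

(* The library's norm on ['rV[R]_d] is the sup norm, hence this definition. *)
Definition euclid_dist (R : realType) (d : nat) (x y : 'rV[R]_d) : R :=
  Num.sqrt (\sum_(i < d) (x ord0 i - y ord0 i) ^+ 2).

Definition dist_set (R : realType) (d : nat) (x : 'rV[R]_d)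
    (S : set 'rV[R]_d) : R :=
  inf [set euclid_dist x y | y in S].

Definition box (R : realType) (d : nat) (a b : 'rV[R]_d) : set 'rV[R]_d :=
  [set x | forall i, a ord0 i <= x ord0 i <= b ord0 i].

Definition box_cover (R : realType) (d : nat) (A : set 'rV[R]_d)
    (a b : nat -> 'rV[R]_d) : Prop :=
  (forall k i, a k ord0 i <= b k ord0 i) /\
  A `<=` \bigcup_k box (a k) (b k).

(* The d-dimensional Lebesgue outer measure; its restriction to the Borel sets
   is the Lebesgue measure on R^d. *)
Definition lebesgue_measure_rV (R : realType) (d : nat)
    (A : set (borel_space R d)) : \bar R :=
  ereal_inf [set v : \bar R | exists a b : nat -> 'rV[R]_d,
    box_cover A a b /\
    v = (\sum_(0 <= k <oo) (\prod_(i < d) (b k ord0 i - a k ord0 i))%:E)%E].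

(* [F(S)], the average distance from the points of [Omega] to [S] *)
Definition location_cost (R : realType) (d : nat) (Omega : set 'rV[R]_d)
    (nu : probability (borel_space R d) R) (S : set 'rV[R]_d) : \bar R :=
  (\int[nu]_(x in Omega) (dist_set x S)%:E)%E.

Definition admissible (R : realType) (d : nat) (Omega : set 'rV[R]_d)
    (S0 : set 'rV[R]_d) (n : nat) (S : set 'rV[R]_d) : Prop :=
  [/\ S0 `<=` S, S `<=` Omega, S !=set0 & (S #<= `I_n)%card].

Definition short_term_solution (R : realType) (d : nat)
    (Omega : set 'rV[R]_d) (nu : probability (borel_space R d) R)
    (Sigma : nat -> set 'rV[R]_d) : Prop :=
  Sigma 0%N = set0 /\
  forall n : nat, (1 <= n)%N ->
    admissible Omega (Sigma n.-1) n (Sigma n) /\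
    forall S, admissible Omega (Sigma n.-1) n S ->
      (location_cost Omega nu (Sigma n) <= location_cost Omega nu S)%E.

(* Main.v *)
Require Import Defs.
From mathcomp Require Import all_boot all_order all_algebra.
From mathcomp Require Import all_classical all_reals all_analysis.
From mathcomp Require Import measurable_realfun.
From mathcomp Require Import ring lra.
Import Order.TTheory GRing.Theory Num.Theory.
Import numFieldNormedType.Exports.
Local Open Scope classical_set_scope.
Local Open Scope ring_scope.

(* Lower bound: by absolute continuity, sets of small Lebesgue measure have
   nu-measure below 1/2; n cubes of side comparable to n^(-1/d) have small total
   volume, so at least half of the mass lies at distance of order n^(-1/d) from
   any n points.

   Upper bound: let s = F(S). Omega is covered by N <= C s^(-d) balls of radius
   s/2 centred in Omega. Each x is within s/2 of some centre, so the gains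
   F(S) - F(S + y), summed over all the centres y, total at least s - s/2; the
   best centre gains at least s/(2N) >= c s^(d+1). Hence
   s_(n+1) <= s_n - c s_n^(d+1), and c n s_n^d <= 1 follows by induction on n. *)

(** * Lebesgue outer measure and absolute continuity *)

Section LebesgueOuterMeasure.
Context (R : realType) (d : nat).
Local Notation mu := (@lebesgue_measure_rV R d).
Implicit Types (A B : set (borel_space R d)) (a b : nat -> 'rV[R]_d).

Lemma box_volume_ge0 a b k : (forall k i, a k ord0 i <= b k ord0 i) ->
  0 <= \prod_(i < d) (b k ord0 i - a k ord0 i).
Proof. by move=> ab; apply: prodr_ge0 => i _; rewrite subr_ge0. Qed.

Lemma lebesgue_measure_rV_ge0 A : (0 <= mu A)%E.
Proof.
apply: le_ereal_inf_tmp => _ [a [b [[ab _] ->]]].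
by apply: nneseries_ge0 => k _ _; rewrite lee_fin box_volume_ge0.
Qed.

Lemma le_lebesgue_measure_rV A B : A `<=` B -> (mu A <= mu B)%E.
Proof.
move=> AB; apply: ereal_inf_le_tmp => _ [a [b [[ab cov] ->]]].
by exists a, b; split => //; split => //; exact: subset_trans cov.
Qed.

Lemma lebesgue_measure_rV_box (c e : 'rV[R]_d) : (0 < d)%N ->
  (forall i, c ord0 i <= e ord0 i) ->
  (mu (box c e) <= (\prod_(i < d) (e ord0 i - c ord0 i))%:E)%E.
Proof.
move=> d0 ce; apply: ereal_inf_lbound => /=.
(* All boxes after the first are degenerate at [c]. Their volume vanishes only because [0 < d]: for
   [d = 0] the empty product would be 1. *)
exists (fun=> c), (fun k => if k is 0%N then e else c); split.
  split=> [[|k] i //|x cex]; by exists 0%N.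
have S0 k : (0 <= (\prod_(i < d)
    ((if k is 0%N then e else c) ord0 i - c ord0 i))%:E :> \bar R)%E.
  by rewrite lee_fin; apply: prodr_ge0 => i _; case: k => [|k]; rewrite ?subr_ge0 ?subrr.
rewrite (nneseries_split 0 1)//= big_nat1/= add0n eseries0 ?adde0//.
move=> [//|k] _ _; case: (d) d0 (c) => // n _ c'.
by rewrite big_ord_recl subrr mul0r.
Qed.

Lemma lebesgue_measure_rV0 : (0 < d)%N -> mu set0 = 0%E.
Proof.
move=> d0; apply/eqP; rewrite eq_le lebesgue_measure_rV_ge0 andbT.
apply: (@le_trans _ _ (mu (box 0 0))); first exact: le_lebesgue_measure_rV.
apply: le_trans (lebesgue_measure_rV_box 0 0 d0 _) _ => //.
by case: (d) d0 => // n _; rewrite big_ord_recl subrr mul0r.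
Qed.

(** If every [A n] has finite outer measure, each is covered by boxes with an excess of at most e /
    2^(n+1). A bijection between [nat] and pairs merges these covers into one sequence, of total
    volume at most the right-hand side plus [e]. *)
Lemma lebesgue_measure_rV_sigma_subadditive (A : nat -> set (borel_space R d)) :
  (mu (\bigcup_n A n) <= \sum_(0 <= n <oo) mu (A n))%E.
Proof.
have [[i ioo]|] := pselect (exists i, mu (A i) = +oo%E).
  rewrite (eseries_pinfty _ _ ioo) ?leey// => n _.
  by rewrite -ltNye (lt_le_trans _ (lebesgue_measure_rV_ge0 _)).
rewrite -forallNE => Aoo.
apply/lee_addgt0Pr => e e0.
rewrite (le_trans _ (epsilon_trick _ _ (ltW e0)))//; last first.
  by move=> n; exact: lebesgue_measure_rV_ge0.
pose vol (c : 'rV[R]_d * 'rV[R]_d) : \bar R :=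
  (\prod_(i < d) (c.2 ord0 i - c.1 ord0 i))%:E.
pose P n (G : nat -> 'rV[R]_d * 'rV[R]_d) :=
  box_cover (A n) (fst \o G) (snd \o G) /\
  (\sum_(0 <= k <oo) vol (G k) <= mu (A n) + (e / (2 ^ n.+1)%:R)%:E)%E.
have [G PG] : {G : nat -> nat -> 'rV[R]_d * 'rV[R]_d & forall n, P n (G n)}.
  apply: (@choice _ _ P) => n.
  have en : 0 < e / (2 ^ n.+1)%:R by rewrite divr_gt0// ltr0n expn_gt0.
  have /(lb_ereal_inf_adherent en) : mu (A n) \is a fin_num.
    by rewrite ge0_fin_numE ?lebesgue_measure_rV_ge0// ltey; exact/eqP.
  move=> [_ [a [b [ab ->]]] /ltW le].
  by exists (fun k => (a k, b k)).
have vol0 n k : (0 <= vol (G n k))%E.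
  by rewrite lee_fin; apply: prodr_ge0 => i _; rewrite subr_ge0; exact: (PG n).1.1.
have /card_esym/ppcard_eqP[f] := card_nat2.
apply: (@le_trans _ _ (\sum_(0 <= k <oo) vol (uncurry G (f k)))%E).
  apply: ereal_inf_lbound => /=.
  exists (fun k => (uncurry G (f k)).1), (fun k => (uncurry G (f k)).2).
  split=> //; split=> [k i|x [n _ Anx]].
    by case: (f k) => n m /=; exact: (PG n).1.1.
  have [m _ xm] := (PG n).1.2 x Anx.
  by exists (f^-1%FUN (n, m)) => //=; rewrite invK ?inE.
apply: (@le_trans _ _ (\sum_(0 <= n <oo) \sum_(0 <= k <oo) vol (G n k))%E); last first.
  apply: lee_nneseries => n _; first by move=> _; apply: nneseries_ge0.
  exact: (PG n).2.
rewrite nneseries_esumT; last by move=> k; case: (f k) => n m; exact: vol0.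
rewrite -(reindex_esum setT setT f (fun i => vol (uncurry G i))); last exact: bij.
under [in leRHS]eq_eseriesr do rewrite nneseries_esumT//.
rewrite nneseries_esumT; last by move=> n; exact: esum_ge0.
rewrite (@esum_esum _ _ _ setT (fun=> setT) (fun n m => vol (G n m)))//.
rewrite (_ : setT `*`` _ = setT); last by apply/seteqP; split => -[].
by rewrite le_eqVlt; apply/orP; left; apply/eqP; apply: eq_esum => -[].
Qed.

Lemma lebesgue_measure_rV_cubes (r : R) n (p : nat -> 'rV[R]_d) :
  (0 < d)%N -> 0 <= r ->
  (mu (\bigcup_(k in `I_n) box (p k - const_mx r) (p k + const_mx r))
     <= (n%:R * (r *+ 2) ^+ d)%:E)%E.
Proof.
move=> d0 r0; rewrite bigcup_mkcond.
apply: le_trans (lebesgue_measure_rV_sigma_subadditive _) _.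
rewrite (nneseries_split 0 n); last by move=> k _; exact: lebesgue_measure_rV_ge0.
rewrite add0n [X in (_ + X)%E]eseries0 ?adde0; last first.
  move=> k nk _; rewrite ifF ?lebesgue_measure_rV0//.
  by apply/negbTE; rewrite notin_setE /= ltnNge nk.
have -> : (n%:R * (r *+ 2) ^+ d)%:E = (\sum_(0 <= k < n) ((r *+ 2) ^+ d)%:E)%E :> \bar R.
  by rewrite sumEFin sumr_const_nat subn0 mulr_natl.
rewrite !big_nat; apply: lee_sum => k /andP[_ kn].
rewrite ifT; last by rewrite inE.
apply: (le_trans (lebesgue_measure_rV_box _ _ d0 _)) => [i|].
  by rewrite !mxE lerD2l (le_trans _ r0)// oppr_le0.
rewrite lee_fin (eq_bigr (fun=> r *+ 2)) ?prodr_const ?card_ord// => i _.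
by rewrite !mxE opprB [X in X + _]addrC addrACA subrr addr0 mulr2n.
Qed.

End LebesgueOuterMeasure.

(** Borel-Cantelli by contradiction: otherwise there are sets [F n] of outer measure at most 1 /
    2^(n+1) with [nu (F n)] at least [e]. Their limit superior is Lebesgue-null, yet [nu] gives it
    mass at least [e]. *)
Lemma absolute_continuity_eps (R : realType) (d : nat)
    (nu : {finite_measure set (borel_space R d) -> \bar R}) (e : R) :
  nu `<< @lebesgue_measure_rV R d -> 0 < e ->
  exists2 delta : R, 0 < delta & forall A, measurable A ->
    (lebesgue_measure_rV A <= delta%:E)%E -> (nu A < e%:E)%E.
Proof.
move=> nuac e0; apply: contrapT => /forall2NP H.
have {}H n : exists A : set (borel_space R d), [/\ measurable A,
    (lebesgue_measure_rV A <= (1 / (2 ^ n.+1)%:R)%:E)%E & (e%:E <= nu A)%E].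
  have [|] := H (1 / (2 ^ n.+1)%:R).
    by move/negP; rewrite divr_gt0// ltr0n expn_gt0.
  move/existsNP => [A] /not_implyP[mA] /not_implyP[muA] /negP.
  by rewrite -leNgt => nuA; exists A.
have [F HF] := choice H.
have mF i : measurable (F i) by have [] := HF i.
have mL : measurable (lim_sup_set F).
  by apply: bigcap_measurable => // k _; exact: bigcup_measurable.
have L0 : lebesgue_measure_rV (lim_sup_set F) = 0%E.
  apply/eqP; rewrite eq_le lebesgue_measure_rV_ge0 andbT.
  have sum_fin : (\sum_(0 <= n <oo) lebesgue_measure_rV (F n) < +oo)%E.
    apply: le_lt_trans (ltry 1).
    apply: le_trans (epsilon_trick0 xpredT ler01).
    apply: lee_nneseries => n _; first by move=> _; exact: lebesgue_measure_rV_ge0.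
    by have [] := HF n.
  (* The limit superior lies in every tail union, whose outer measure is at most the tail of a
     convergent series. *)
  have tail := nneseries_tail_cvg sum_fin (fun n _ => lebesgue_measure_rV_ge0 _ _ _).
  have /cvg_lim <- // := tail.
  apply: lime_ge; first by apply/cvg_ex; exists 0%E.
  apply: nearW => n.
  apply: le_trans (le_lebesgue_measure_rV _ _ _ _ (bigcap_inf (I : setT n))) _.
  apply: (@le_trans _ _ (lebesgue_measure_rV (\bigcup_k F (k + n)%N))).
    apply: le_lebesgue_measure_rV => x [k /= nk Fkx].
    by exists (k - n)%N => //; rewrite subnK.
  apply: le_trans (lebesgue_measure_rV_sigma_subadditive _ _ _) _.
  rewrite (@nneseries_addn _ (fun k => lebesgue_measure_rV (F k)))// => k.
  exact: lebesgue_measure_rV_ge0.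
have : nu (lim_sup_set F) = 0%E.
  apply: (nuac (lim_sup_set F)) => //  B mB BL.
  apply/eqP; rewrite eq_le lebesgue_measure_rV_ge0 andbT -L0.
  exact: le_lebesgue_measure_rV.
apply/eqP; rewrite neq_lt// ltNge measure_ge0//=.
suff : (e%:E <= nu (lim_sup_set F))%E by exact: lt_le_trans.
have enu n : (e%:E <= nu (\bigcup_(j >= n) F j))%E.
  have [_ _ /le_trans] := HF n; apply.
  rewrite le_measure// ?inE//; first exact: bigcup_measurable.
  by apply: bigcup_sup => /=.
(* Continuity from above along the decreasing tail unions, available since [nu] is finite. *)
have /(_ _ _)/cvg_lim <-// := lim_sup_set_cvg nu F.
  apply: lime_ge.
    apply: ereal_nonincreasing_is_cvgn => a b ab.
    rewrite le_measure ?inE//; [exact: bigcup_measurable|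
                                exact: bigcup_measurable|].
    by apply: bigcup_subset => n/=; exact: leq_trans.
  by apply: nearW => k; exact: enu.
by rewrite -ge0_fin_numE// fin_num_measure//; exact: bigcup_measurable.
Qed.

(** * Euclidean distance and distance to a set *)

Section Distance.
Context (R : realType) (d : nat).
Implicit Types (x y : 'rV[R]_d) (S T : set 'rV[R]_d).

Lemma euclid_dist_ge0 x y : 0 <= euclid_dist x y.
Proof. exact: sqrtr_ge0. Qed.

Lemma le_coord_euclid_dist x y i : `|x ord0 i - y ord0 i| <= euclid_dist x y.
Proof.
rewrite -sqrtr_sqr ler_sqrt; last by apply: sumr_ge0 => j _; exact: sqr_ge0.
by rewrite (bigD1 i)//= lerDl; apply: sumr_ge0 => j _; exact: sqr_ge0.
Qed.

(** The sharp factor sqrt(d) is rounded up to [d]; only constants are affected. *)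
Lemma euclid_dist_le x y (e : R) : 0 <= e ->
  (forall i, `|x ord0 i - y ord0 i| <= e) -> euclid_dist x y <= d%:R * e.
Proof.
move=> e0 xye; have de0 : 0 <= d%:R * e by rewrite mulr_ge0.
rewrite -[leRHS]ger0_norm// -sqrtr_sqr ler_sqrt ?sqr_ge0//.
apply: (@le_trans _ _ (\sum_(i < d) e ^+ 2)).
  by apply: ler_sum => i _; rewrite -real_normK ?num_real// lerXn2r// nnegrE.
rewrite sumr_const card_ord exprMn -[leLHS]mulr_natl ler_wpM2r ?sqr_ge0//.
by rewrite -natrX ler_nat; case: (d) => // n; rewrite -mulnn leq_pmulr.
Qed.

Lemma continuous_euclid_dist y : continuous (fun x => euclid_dist x y).
Proof.
move=> x; apply: (@continuous_comp _ _ _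
  (fun x => \sum_(i < d) (x ord0 i - y ord0 i) ^+ 2) Num.sqrt); last first.
  exact: sqrt_continuous.
apply: continuous_big => [|i _ z]; first exact: add_continuous.
have cvgi : u ord0 i - y ord0 i @[u --> z] --> z ord0 i - y ord0 i.
  by apply: cvgB; [exact: coord_continuous|exact: cvg_cst].
exact: (cvgM cvgi cvgi).
Qed.

Lemma dist_set_le x y S : S y -> dist_set x S <= euclid_dist x y.
Proof.
move=> Sy; apply: ge_inf; last by exists y.
by exists 0 => _ [z _ <-]; exact: euclid_dist_ge0.
Qed.

(** Nonemptiness matters: the infimum of the empty set is 0 by convention, so the bound would fail
    for positive [r]. *)
Lemma dist_set_ge x S (r : R) : S !=set0 ->
  (forall y, S y -> r <= euclid_dist x y) -> r <= dist_set x S.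
Proof.
move=> [y Sy] rS; apply: lb_le_inf => [|_ [z Sz <-]]; last exact: rS.
by exists (euclid_dist x y), y.
Qed.

Lemma dist_set_ge0 x S : S !=set0 -> 0 <= dist_set x S.
Proof. by move=> S0; apply: dist_set_ge => // y _; exact: euclid_dist_ge0. Qed.

Lemma dist_set_subset x S T : S !=set0 -> S `<=` T -> dist_set x T <= dist_set x S.
Proof. by move=> S0 ST; apply: dist_set_ge => // y /ST; exact: dist_set_le. Qed.

Lemma dist_set_lt x S (r : R) : S !=set0 ->
  dist_set x S < r <-> exists2 y, S y & euclid_dist x y < r.
Proof.
move=> S0; split=> [|[y Sy]]; last exact: le_lt_trans (dist_set_le _ _ _ Sy).
have [z Sz] := S0.
move=> /inf_lt [|_ [y Sy <-] xyr]; last by exists y.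
by exists (euclid_dist x z), z.
Qed.

(** The set is a union of open Euclidean balls centred in [S]. Borel measurability of the distance
    function rests on this. *)
Lemma open_dist_set_lt S (r : R) : S !=set0 -> open [set x | dist_set x S < r].
Proof.
move=> S0; rewrite (_ : [set x | _] =
    \bigcup_(y in S) [set x | euclid_dist x y < r]); last first.
  by apply/seteqP; split=> x; rewrite /= dist_set_lt.
apply: bigcup_open => y _.
have /continuousP/(_ _ (@open_lt R r)) := continuous_euclid_dist y.
exact.
Qed.

Lemma measurable_dist_set S (D : set (borel_space R d)) : S !=set0 ->
  measurable_fun D (fun x => dist_set x S).
Proof.
move=> S0; suff mT : measurable_fun [set: borel_space R d] (fun x => dist_set x S).
  exact: measurable_funS mT.
apply: (measurability _ (RGenInftyO.measurableE R)) => _ [_ [r ->] <-].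
apply: measurableI => //; apply: sub_sigma_algebra.
rewrite (_ : _ @^-1` _ = [set x | dist_set x S < r]).
  exact: open_dist_set_lt.
by apply/seteqP; split=> x /=; rewrite in_itv.
Qed.

Lemma measurable_compact (K : set 'rV[R]_d) :
  compact K -> measurable (K : set (borel_space R d)).
Proof.
move=> /compact_closed cK; rewrite -[K]setCK; apply: measurableC.
by apply: sub_sigma_algebra; apply: closed_openC; exact: cK.
Qed.

End Distance.

(** Turns a cardinality bound into an enumeration, possibly with repetitions, by a total function;
    [x0] provides one when [A] is empty. *)
Lemma card_le_II_image (T : Type) (x0 : T) (A : set T) n :
  (A #<= `I_n)%card <-> exists p : nat -> T, A `<=` p @` `I_n.
Proof.
split=> [/pfcard_geP[->|[p]]|[p Ap]]; first by exists (fun=> x0).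
  by exists p; rewrite image_eq.
exact: card_le_trans (subset_card_le Ap) (card_image_le _ _).
Qed.

Lemma card_le_II_setU1 (T : Type) (A : set T) (y : T) n :
  (A #<= `I_n)%card -> (A `|` [set y] #<= `I_n.+1)%card.
Proof.
move=> /(card_le_II_image _ y)[p Ap]; apply/(card_le_II_image _ y).
exists (fun k => if k == n then y else p k) => x [/Ap[k /= kn <-]|->].
  by exists k; rewrite /= ?ltn_eqF// ltnW.
by exists n; rewrite /= ?eqxx.
Qed.

(** * The average distance functional *)

Section LocationCost.
Context (R : realType) (d : nat) (Omega : set 'rV[R]_d)
  (nu : probability (borel_space R d) R)
  (Omega_compact : compact Omega) (nu_Omega : nu Omega = 1%E).
Local Notation F := (location_cost Omega nu).
Implicit Types (S T : set 'rV[R]_d) (r : R).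

Let mOmega : measurable (Omega : set (borel_space R d)).
Proof. exact: measurable_compact. Qed.

Let mdist S : S !=set0 ->
  measurable_fun (Omega : set (borel_space R d)) (fun x => (dist_set x S)%:E).
Proof. by move=> S0; apply/measurable_EFinP; exact: measurable_dist_set. Qed.

Let dist0 S : S !=set0 ->
  forall x : borel_space R d, Omega x -> (0 <= (dist_set x S)%:E)%E.
Proof. by move=> S0 x _; rewrite lee_fin dist_set_ge0. Qed.

Let integral_cstE r : r%:E = (\int[nu]_(x in Omega) (cst r%:E x))%E.
Proof.
by rewrite integral_cst// -[LHS]mule1; congr (_ * _)%E; rewrite -nu_Omega.
Qed.

Lemma location_cost_ge0 S : S !=set0 -> (0 <= F S)%E.
Proof. by move=> S0; apply: integral_ge0 => x Ox; exact: dist0. Qed.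

Lemma location_cost_le S r : S !=set0 ->
  (forall x, Omega x -> dist_set x S <= r) -> (F S <= r%:E)%E.
Proof.
move=> S0 Sr.
rewrite (integral_cstE r).
by apply: ge0_le_integral => //; [exact: dist0|exact: mdist].
Qed.

Lemma location_cost_subset S T : S !=set0 -> S `<=` T -> (F T <= F S)%E.
Proof.
move=> S0 ST; have T0 : T !=set0 by have [y /ST] := S0; exists y.
apply: ge0_le_integral => //; [exact: dist0|exact: mdist|exact: mdist|].
by move=> x _; rewrite lee_fin; exact: dist_set_subset.
Qed.

(** Markov's inequality: on [Omega] minus the [r]-neighbourhood of [S] the integrand is at least
    [r], and that difference has mass at least one minus the mass of the neighbourhood. *)
Lemma location_cost_markov S r : S !=set0 -> 0 <= r ->
  (r%:E * (1 - nu [set x | (dist_set x S < r)%R]) <= F S)%E.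
Proof.
move=> S0 r0.
pose A : set (borel_space R d) := [set x | dist_set x S < r].
have mA : measurable A by apply: sub_sigma_algebra; exact: open_dist_set_lt.
pose B : set (borel_space R d) := Omega `\` A.
have mB : measurable B by exact: measurableD.
apply: (@le_trans _ _ (\int[nu]_(x in B) (dist_set x S)%:E)%E); last first.
  by apply: ge0_subset_integral => //; [exact: mdist|exact: dist0|exact: subDsetl].
apply: (@le_trans _ _ (\int[nu]_(x in B) (cst r%:E x))%E); last first.
  apply: ge0_le_integral => //.
    by apply: measurable_funS (mdist _ S0) => //; exact: subDsetl.
  by move=> x [_ /negP]; rewrite -leNgt lee_fin.
rewrite integral_cst//; apply: lee_pmul => //; first by rewrite -probability_setC.
have nuB : (nu B = 1 - nu ((Omega : set (borel_space R d)) `&` A))%E.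
  rewrite -nu_Omega; apply: measureD => //.
  by apply: (@le_lt_trans _ _ 1%E); [exact: probability_le1|exact: ltry].
suff : (1 - nu A <= nu B)%E by [].
rewrite nuB; apply: leeB => //; apply: le_measure; rewrite ?inE//.
exact: measurableI.
Qed.

(* Says that the gains [F S - F (S `|` [set y i])] sum to at least [F S - r],
   arranged so that no extended reals are subtracted. *)
Lemma location_cost_greedy S r (m : \bar R) (I : finType) (y : I -> 'rV[R]_d) :
  S !=set0 -> 0 <= r ->
  (forall x, Omega x -> exists i, euclid_dist x (y i) <= r) ->
  (forall i, (m <= F (S `|` [set y i]))%E) ->
  (F S + \sum_(i : I) m <= r%:E + #|I|%:R%:E * F S)%E.
Proof.
move=> S0 r0 yr my.
have Sy0 i : S `|` [set y i] !=set0 by have [z Sz] := S0; exists z; left.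
apply: (@le_trans _ _ (F S + \sum_(i : I) F (S `|` [set y i])))%E.
  by rewrite leeD2l//; apply: lee_sum => i _.
rewrite -ge0_integral_sum//; [|by move=> i; exact: mdist|by move=> i; exact: dist0].
rewrite -ge0_integralD//; [|exact: dist0|exact: mdist| |]; last 2 first.
- by move=> x Ox; apply: sume_ge0 => i _; exact: dist0.
- by apply: emeasurable_sum => i; exact: mdist.
rewrite -ge0_integralZl_EFin//; [|exact: dist0|exact: mdist].
rewrite (integral_cstE r).
have mN : measurable_fun (Omega : set (borel_space R d))
    (fun x => #|I|%:R%:E * (dist_set x S)%:E)%E.
  by apply: emeasurable_funM => //; exact: mdist.
rewrite -ge0_integralD//; last by move=> x Ox; rewrite mule_ge0// dist0.
apply: ge0_le_integral => //.
- by move=> x Ox; rewrite adde_ge0 ?sume_ge0// => [|i _]; exact: dist0.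
- apply: emeasurable_funD; first exact: mdist.
  by apply: emeasurable_sum => i; exact: mdist.
- exact: emeasurable_funD.
move=> x Ox; rewrite sumEFin -EFinM -!EFinD lee_fin.
have [i0 xi0] := yr x Ox.
(* The centre [y i0] near [x] contributes at most [r]. Each other term is at most [dist_set x S],
   and the summand from [F S] fills the slot of [i0] on the right. *)
rewrite (bigD1 i0)//= addrCA lerD//.
  by apply: le_trans xi0; apply: dist_set_le; right.
rewrite mulr_natl -sumr_const [leRHS](bigD1 i0)//= lerD2l.
apply: ler_sum => i _.
by apply: dist_set_subset => //; exact: subsetUl.
Qed.

End LocationCost.

(** * Finite nets of bounded sets *)

Lemma compact_coord_bounded (R : realType) (d : nat) (K : set 'rV[R]_d) :
  compact K -> exists2 M : R, 0 < M & forall x i, K x -> `|x ord0 i| <= M.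
Proof.
move=> cK.
have : compact ((fun x => euclid_dist x 0) @` K).
  apply: continuous_compact cK; apply: continuous_subspaceT.
  exact: continuous_euclid_dist.
move=> /compact_bounded/ex_strict_bound_gt0[M M0 KM].
exists M => // x i Kx; apply/ltW; apply: le_lt_trans (KM (euclid_dist x 0) _); last by exists x.
rewrite [leRHS]ger0_norm ?euclid_dist_ge0//.
by have := le_coord_euclid_dist _ _ x 0 i; rewrite mxE subr0.
Qed.

(** The cube [-M, M]^d is cut into cells of side 2M/k. The centres are taken in [K] so that they may
    be added to an admissible set. There are [k.+1] indices per coordinate because the right end [M]
    gets index [k]. *)
Lemma finite_net (R : realType) (d : nat) (K : set 'rV[R]_d) (M : R) (k : nat) :
  0 < M -> (0 < k)%N -> K !=set0 ->
  (forall x i, K x -> `|x ord0 i| <= M) ->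
  exists y : {ffun 'I_d -> 'I_k.+1} -> 'rV[R]_d, (forall c, K (y c)) /\
    forall x, K x -> exists c, euclid_dist x (y c) <= d%:R * (2 * M / k%:R).
Proof.
move=> M0 k0 [z Kz] KM.
have k0' : 0 < k%:R :> R by rewrite ltr0n.
(* [g x] is the grid cell of [x]; one point of [K] per nonempty cell suffices. *)
pose t (x : 'rV[R]_d) i := (x ord0 i + M) * (k%:R / (2 * M)).
pose g (x : 'rV[R]_d) : {ffun 'I_d -> 'I_k.+1} :=
  [ffun i => inord (Num.truncn (t x i))].
have t_itv x i : K x -> 0 <= t x i <= k%:R.
  move=> /(KM _ i); rewrite ler_norml => /andP[Mx xM].
  apply/andP; split.
    apply: mulr_ge0; first by lra.
    by rewrite divr_ge0 ?mulr_ge0 ?ltW.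
  by rewrite /t mulrCA ger_pMr// ler_pdivrMr ?mulr_gt0//; lra.
have [y yP] : {y : {ffun 'I_d -> 'I_k.+1} -> 'rV[R]_d &
    forall c, K (y c) /\ forall x, K x -> g x = c -> g (y c) = c}.
  apply: (@choice _ _ (fun c y => K y /\ forall x, K x -> g x = c -> g y = c)) => c.
  have [[x [Kx gx]]|noc] := pselect (exists x, K x /\ g x = c); first by exists x.
  by exists z; split => // x Kx gx; case: noc; exists x.
exists y; split=> [c|x Kx]; first by have [] := yP c.
exists (g x); have [Ky /(_ x Kx erefl) gyx] := yP (g x).
apply: euclid_dist_le => [|i]; first by rewrite divr_ge0 ?mulr_ge0 ?ltW.
have /andP[tx0 txk] := t_itv x i Kx; have /andP[ty0 tyk] := t_itv _ i Ky.
have truncn_lt (u : R) : 0 <= u <= k%:R -> (Num.truncn u < k.+1)%N.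
  by move=> /andP[u0 uk]; rewrite ltnS -(ler_nat R) (le_trans _ uk)// truncn_le.
have := congr1 (fun h : {ffun 'I_d -> 'I_k.+1} => nat_of_ord (h i)) gyx.
rewrite !ffunE !inordK ?truncn_lt ?t_itv// => exy.
have /andP[] := truncn_itv tx0; have /andP[] := truncn_itv ty0.
rewrite exy -natr1 => y1 y2 x1 x2.
have -> : x ord0 i - y (g x) ord0 i = (t x i - t (y (g x)) i) * (2 * M / k%:R).
  by rewrite /t; field; rewrite !gt_eqF.
have w0 : 0 < 2 * M / k%:R by rewrite divr_gt0// mulr_gt0.
rewrite normrM (gtr0_norm w0) ger_pMl//.
(* Two reals with the same integer part differ by less than 1. *)
by rewrite ler_norml; apply/andP; split; lra.
Qed.

(** * Decay rate of a recursive inequality *)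

Lemma powR_invnK (R : realType) (a : R) (d : nat) : (0 < d)%N -> 0 <= a ->
  (a `^ d%:R^-1) ^+ d = a.
Proof.
by move=> d0 a0; rewrite -powR_mulrn ?powR_ge0// -powRrM mulVf ?powRr1// pnatr_eq0 -lt0n.
Qed.

(** With z = c s_n^d, the hypothesis gives s_(n+1)^d <= s_n^d (1-z)^d <= s_n^d (1-z). Since (n+1) z
    <= 1, it follows that (n+2) z (1-z) <= (1+z)(1-z) <= 1. *)
Lemma decay_of_superlinear_decrease (R : realFieldType) (s : nat -> R) (c : R)
    (d : nat) :
  (0 < d)%N -> 0 <= c -> (forall n, 0 <= s n) -> c * s 0%N ^+ d <= 1 ->
  (forall n, s n.+1 + c * s n ^+ d.+1 <= s n) ->
  forall n, c * n.+1%:R * s n ^+ d <= 1.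
Proof.
move=> d0 c0 s0 cs1 dec; elim=> [|n IH]; first by rewrite mulr1.
pose z := c * s n ^+ d.
have z0 : 0 <= z by rewrite mulr_ge0// exprn_ge0.
have nz : n.+1%:R * z <= 1 by rewrite /z mulrCA mulrA.
have z1 : z <= 1 by apply: le_trans nz; rewrite ler_peMl// ler1n.
have le1 : s n.+1 <= s n * (1 - z).
  by rewrite mulrBr mulr1 lerBrDr /z mulrCA -exprS.
have le2 : s n.+1 ^+ d <= s n ^+ d * (1 - z).
  apply: (@le_trans _ _ (s n ^+ d * (1 - z) ^+ d)).
    rewrite -exprMn; apply: lerXn2r => //; rewrite nnegrE//.
    by rewrite mulr_ge0// subr_ge0.
  by rewrite ler_wpM2l ?exprn_ge0// -[leRHS]expr1 ler_wiXn2l ?subr_ge0// gerBl.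
apply: (@le_trans _ _ (n.+2%:R * (z * (1 - z)))).
  by rewrite /z -[c * n.+2%:R]mulrC -!mulrA ler_wpM2l// ler_wpM2l.
rewrite -natr1 mulrDl mul1r mulrA -mulrDl.
apply: (@le_trans _ _ ((1 + z) * (1 - z))).
  by rewrite ler_wpM2r ?subr_ge0// lerD2r.
by have := sqr_ge0 z; lra.
Qed.

(** * Lower bound *)

Lemma location_cost_lower (R : realType) (d : nat) (Omega : set 'rV[R]_d)
    (nu : probability (borel_space R d) R) :
  (0 < d)%N -> compact Omega -> nu Omega = 1%E ->
  nu `<< @lebesgue_measure_rV R d ->
  exists2 C : R, 0 < C & forall n S, (0 < n)%N -> S !=set0 -> (S #<= `I_n)%card ->
    ((C * n%:R `^ (- d%:R^-1))%:E <= location_cost Omega nu S)%E.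
Proof.
move=> d0 cOmega nuOmega nuac.
have h0 : 0 < 2^-1 :> R by rewrite invr_gt0.
have [delta delta0 small] := absolute_continuity_eps _ _ nu _ nuac h0.
(* One factor 1/2 comes from the half-side [r] below, the other from the mass at distance at least
   [r]. *)
exists (delta `^ d%:R^-1 / 4); first by rewrite divr_gt0// powR_gt0.
move=> n S n0 S0 /(card_le_II_image _ 0)[p Sp].
have n0' : 0 < n%:R :> R by rewrite ltr0n.
(* Chosen so that [n] cubes of half-side [r] have total volume exactly [delta]. *)
pose r := (delta / n%:R) `^ d%:R^-1 / 2.
have r0 : 0 <= r by rewrite divr_ge0// powR_ge0.
pose A : set (borel_space R d) := [set x | dist_set x S < r].
have mA : measurable A by apply: sub_sigma_algebra; exact: open_dist_set_lt.
have nuA : (nu A < 2^-1%:E)%E.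
  apply: small => //.
  apply: (@le_trans _ _ (lebesgue_measure_rV (\bigcup_(k in `I_n)
      box (p k - const_mx r) (p k + const_mx r)))).
    apply: le_lebesgue_measure_rV => x /dist_set_lt-/(_ S0)[y /Sp[k kn <-] xpr].
    exists k => // i; rewrite !mxE.
    have := le_lt_trans (le_coord_euclid_dist _ _ _ _ i) xpr.
    by rewrite ltr_norml => /andP[? ?]; apply/andP; split; lra.
  apply: le_trans (lebesgue_measure_rV_cubes _ _ _ _ _ d0 r0) _.
  have -> : r *+ 2 = (delta / n%:R) `^ d%:R^-1 by rewrite -[LHS]mulr_natr divfK// pnatr_eq0.
  rewrite lee_fin powR_invnK//; last by rewrite divr_ge0 ?ltW.
  by rewrite mulrC divfK ?gt_eqF.
apply: le_trans (location_cost_markov _ _ _ _ cOmega nuOmega _ r S0 r0).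
have -> : delta `^ d%:R^-1 / 4 * n%:R `^ (- d%:R^-1) = r * 2^-1.
  rewrite /r powRM ?invr_ge0 ?ltW// -[n%:R^-1]powR_inv1 ?ltW// -powRrM mulN1r.
  by field.
rewrite EFinM lee_wpmul2l ?lee_fin// leeBrDr ?fin_num_measure//.
apply: le_trans (leeD2l _ (ltW nuA)) _.
by rewrite -EFinD lee_fin; lra.
Qed.

(** * Upper bound *)

(** One greedy step: [t] stands for the next cost. [D] bounds the diameter of [Omega]; the bound on
    the cost is stated along with the step because the same [D] must start the induction. *)
Lemma location_cost_step (R : realType) (d : nat) (Omega : set 'rV[R]_d)
    (nu : probability (borel_space R d) R) :
  (0 < d)%N -> compact Omega -> nu Omega = 1%E ->
  exists2 D : R, 0 < D & forall S, S !=set0 -> S `<=` Omega ->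
    (location_cost Omega nu S <= D%:E)%E /\
    forall s t : R, location_cost Omega nu S = s%:E ->
      (forall y, Omega y -> (t%:E <= location_cost Omega nu (S `|` [set y]))%E) ->
      t + (2 * (4 * D) ^+ d)^-1 * s ^+ d.+1 <= s.
Proof.
move=> d0 cOmega nuOmega.
have [M M0 OM] := compact_coord_bounded _ _ _ cOmega.
have d0' : 0 < d%:R :> R by rewrite ltr0n.
pose D := d%:R * (2 * M); have D0 : 0 < D by rewrite !mulr_gt0.
exists D => // S S0 SO.
have FD : (location_cost Omega nu S <= D%:E)%E.
  apply: location_cost_le => // x Ox; have [y Sy] := S0.
  apply: le_trans (dist_set_le _ _ _ _ _ Sy) _.
  apply: euclid_dist_le => [|i]; first by rewrite mulr_ge0// ltW.
  apply: le_trans (ler_normB _ _) _.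
  by have := OM x i Ox; have := OM y i (SO y Sy); lra.
split=> // s t sE tF.
have s0 : 0 <= s by rewrite -lee_fin -sE location_cost_ge0.
have sD : s <= D by rewrite -lee_fin -sE.
have ts : t <= s.
  have [y Sy] := S0; rewrite -lee_fin -sE; apply: le_trans (tF y (SO y Sy)) _.
  by apply: location_cost_subset => //; exact: subsetUl.
(* The mesh below divides by [s]; for [s = 0] only [t <= s] is left to prove. *)
have [s_eq0|s_neq0] := eqVneq s 0.
  by rewrite s_eq0 expr0n mulr0 addr0 -s_eq0.
have {s_neq0} s_gt0 : 0 < s by rewrite lt_def s_neq0.
have Ds0 : 0 <= 2 * D / s by rewrite divr_ge0 ?mulr_ge0 ?ltW.
(* Fine enough for a net of radius D/k <= s/2, yet k+1 <= 2D/s + 2 <= 4D/s because s <= D. The net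
   thus has at most (4D/s)^d centres. *)
pose k := (Num.truncn (2 * D / s)).+1.
have /andP[klo khi] := truncn_itv Ds0.
have k0 : 0 < k%:R :> R by rewrite ltr0n.
have Dk : D / k%:R <= s / 2.
  have Dks : 2 * D < k%:R * s by rewrite -ltr_pdivrMr.
  by rewrite ler_pdivrMr//; lra.
have kN : k.+1%:R <= 4 * D / s.
  rewrite /k -natr1 -natr1 -addrA; apply: (@le_trans _ _ (2 * D / s + 2 * (D / s))).
    rewrite lerD//.
    have : 1 <= D / s by rewrite ler_pdivlMr// mul1r.
    lra.
  by rewrite -!mulrA -mulrDl; lra.
have [z Oz] : Omega !=set0 by have [y /SO] := S0; exists y.
have O0 : Omega !=set0 by exists z.
have [y [Oy yO]] := finite_net _ _ _ _ k M0 isT O0 OM.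
have := location_cost_greedy _ _ _ _ cOmega nuOmega S (s / 2) t%:E _ y S0.
rewrite sE sumEFin -EFinM -!EFinD lee_fin card_ffun !card_ord sumr_const card_ffun !card_ord.
move=> greedy.
have {greedy} : s + t *+ (k.+1 ^ d) <= s / 2 + (k.+1 ^ d)%:R * s.
  apply: greedy => [||c]; first by rewrite divr_ge0.
    move=> x /yO[c xc]; exists c; apply: le_trans xc _.
    by apply: le_trans Dk; rewrite /D mulrA.
  exact/tF/Oy.
rewrite -[t *+ _]mulr_natl natrX => greedy.
have Nle : k.+1%:R ^+ d <= (4 * D / s) ^+ d.
  by apply: lerXn2r => //; rewrite nnegrE// !divr_ge0 ?mulr_ge0// ltW.
have key : s / 2 <= (4 * D / s) ^+ d * (s - t).
  apply: (@le_trans _ _ (k.+1%:R ^+ d * (s - t))); last first.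
    by rewrite ler_wpM2r// subr_ge0.
  by move: greedy; set N := _ ^+ d; lra.
have sd0 : 0 < s ^+ d by rewrite exprn_gt0.
have Dd0 : 0 < (4 * D) ^+ d by rewrite exprn_gt0// mulr_gt0.
rewrite -lerBrDl mulrC ler_pdivrMr ?mulr_gt0//.
have : s / 2 * s ^+ d <= (4 * D / s) ^+ d * (s - t) * s ^+ d by rewrite ler_pM2r.
rewrite expr_div_n [leRHS]mulrAC divfK ?gt_eqF// exprS.
by set a := s ^+ d; set b := (4 * D) ^+ d; lra.
Qed.

Lemma location_cost_upper (R : realType) (d : nat) (Omega : set 'rV[R]_d)
    (nu : probability (borel_space R d) R) :
  (0 < d)%N -> compact Omega -> nu Omega = 1%E ->
  exists2 C : R, 0 < C & forall Sigma, short_term_solution Omega nu Sigma ->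
    forall n, (0 < n)%N ->
    (location_cost Omega nu (Sigma n) <= (C * n%:R `^ (- d%:R^-1))%:E)%E.
Proof.
move=> d0 cOmega nuOmega.
have [D D0 step] := location_cost_step _ _ _ _ d0 cOmega nuOmega.
pose c := (2 * (4 * D) ^+ d)^-1.
have c0 : 0 < c by rewrite invr_gt0 mulr_gt0// exprn_gt0// mulr_gt0.
exists (c^-1 `^ d%:R^-1); first by rewrite powR_gt0// invr_gt0.
move=> Sigma [_ opt] [//|n] _.
have Sne k : Sigma k.+1 !=set0 by have [[]] := opt k.+1 isT.
have SO k : Sigma k.+1 `<=` Omega by have [[]] := opt k.+1 isT.
have cost0 k : (0 <= location_cost Omega nu (Sigma k.+1))%E.
  exact: location_cost_ge0.
(* Indices are shifted by one, so that the sequence starts at a nonempty set. *)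
pose s k := fine (location_cost Omega nu (Sigma k.+1)).
have sE k : location_cost Omega nu (Sigma k.+1) = (s k)%:E.
  rewrite fineK// ge0_fin_numE//.
  by have [FD _] := step _ (Sne k) (SO k); apply: le_lt_trans FD (ltry _).
have s0 k : 0 <= s k by rewrite -lee_fin -sE.
(* Adding any point of [Omega] to [Sigma k.+1] gives a competitor for [Sigma k.+2], so optimality
   supplies the hypothesis on [t]. *)
have dec k : s k.+1 + c * s k ^+ d.+1 <= s k.
  have [_ /(_ _ _ (sE k))] := step _ (Sne k) (SO k); apply => y Oy.
  rewrite -sE; apply: (opt k.+2 isT).2.
  have [[_ _ _ Sk] _] := opt k.+1 isT.
  split; [exact: subsetUl| |by have [z Sz] := Sne k; exists z; left|].
    by move=> z [/SO//|->].
  exact: card_le_II_setU1.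
have base : c * s 0%N ^+ d <= 1.
  have sD : s 0%N <= D by rewrite -lee_fin -sE; have [] := step _ (Sne 0%N) (SO 0%N).
  rewrite mulrC ler_pdivrMr ?mul1r ?mulr_gt0 ?exprn_gt0 ?mulr_gt0//.
  apply: (@le_trans _ _ ((4 * D) ^+ d)).
    by apply: lerXn2r; rewrite ?nnegrE//; lra.
  by rewrite ler_peMl ?exprn_ge0 ?mulr_ge0 ?ltW//; lra.
have := decay_of_superlinear_decrease _ s c d d0 (ltW c0) s0 base dec n.
rewrite mulrC => cns.
have n0 : 0 < n.+1%:R :> R by rewrite ltr0n.
have -> : c^-1 `^ d%:R^-1 * n.+1%:R `^ (- d%:R^-1) = ((c * n.+1%:R)^-1) `^ d%:R^-1.
  rewrite -mulN1r powRrM powR_inv1; last exact: ltW.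
  by rewrite invfM powRM// invr_ge0 ltW.
rewrite sE lee_fin -(ler_pXn2r d0) ?nnegrE ?powR_ge0//.
rewrite powR_invnK ?invr_ge0 ?mulr_ge0 ?(ltW c0) ?(ltW n0)//.
by rewrite -[leRHS]mul1r ler_pdivlMr// mulr_gt0.
Qed.

Theorem theorem3p2 (R : realType) (d : nat) (hd : (1 <= d)%N)
    (Omega : set 'rV[R]_d) (Omega_compact : compact Omega)
    (Omega_convex : convex_set Omega)
    (nu : probability (borel_space R d) R)
    (nu_Omega : nu Omega = 1%E)
    (nu_ac : nu `<< @lebesgue_measure_rV R d) :
  exists C1 C2 : R, [/\ 0 < C1, 0 < C2 &
    forall Sigma : nat -> set 'rV[R]_d,
      short_term_solution Omega nu Sigma ->
      forall n : nat, (1 <= n)%N ->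
        ((C1 * n%:R `^ (- d%:R^-1))%:E <= location_cost Omega nu (Sigma n))%E
        /\ (location_cost Omega nu (Sigma n)
             <= (C2 * n%:R `^ (- d%:R^-1))%:E)%E].
Proof.
have [C1 C10 lower] := location_cost_lower _ _ _ _ hd Omega_compact nu_Omega nu_ac.
have [C2 C20 upper] := location_cost_upper _ _ _ _ hd Omega_compact nu_Omega.
exists C1, C2; split=> // Sigma sol n n0; split; last exact: upper.
have [[_ _ Sn0 Sn] _] := sol.2 n n0; exact: lower.
Qed.
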